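(* Let $\mathcal{X}$ be a finite set, $U:\mathcal{X}\to\mathbb{R}$ with $\min_xU(x)=0$, and $Q$ the generator of an ergodic continuous-time Markov chain on $\mathcal{X}$ reversible with respect to its stationary distribution $\pi$. Suppose $c_{M_2}\leq 0$, and let $X^{M_2}$ be the non-homogeneous continuous-time Markov chain with generators $(M_{2,t})_{t\ge0}$ and transition semigroup $(P^{M_2}_{s,t})_{0\le s\le t}$. If the (differentiable) cooling schedule $T(t)$ satisfies $$\lim_{t\to\infty}\Big(\frac{d}{dt}T(t)\Big)\frac{e^{c_{M_2}/T(t)}}{T(t)^2}=0,\qquad( * )$$ then $X^{M_2}$ is strongly ergodic and converges to $\pi_{min}$ in total variation distance: for all $s\ge0$, $$\lim_{t\to\infty}\sup_{x\in\mathcal{X}}\|P^{M_2}_{s,t}(x,\cdot)-\pi_{min}\|_{TV}=0.$$ Moreover, if $c_{M_2}=0$, the following cooling schedules satisfy $( * )$: (1) $T(t)=(t+1)^{-\alpha}$ with $\alpha\in(0,1)$; (2) $T(t)=(\log(t+1))^{-k}$ with $k>1$; (3) $T(t)=(t+1)^{-\alpha}(\log(t+1))^{-1}$ with $\alpha\in(0,1)$. If $c_{M_2}<0$, the following cooling schedules, in addition to (1)–(3), satisfy $( * )$: (4) $T(t)=e^{-t}$; (5) $T(t)=(t+1)^{-\alpha}$ with $\alpha>0$. All of these examples satisfy $\lim_{t\to\infty}T(t)\log(t+1)=0$.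
   Context: $\mathcal{X}$ has at least two points. A cooling schedule is a function $T(t)>0$ that is monotonically decreasing to $0$ as $t\to\infty$; for schedules that blow up at $t=0$, $1/T(0)$ is read as $0$. Reversibility: $\pi(x)Q(x,y)=\pi(y)Q(y,x)$ for all $x,y$. For $x\neq y$, $M_{2,t}(x,y)=Q(x,y)\max\{1,e^{(U(x)-U(y))/T(t)}\}=Q(x,y)e^{(U(x)-U(y))_+/T(t)}$ (with $a_+=\max\{a,0\}$), and $M_{2,t}(x,x)=-\sum_{z\neq x}M_{2,t}(x,z)$. $P^{M_2}_{s,t}(x,y)$ is the probability that the chain with these time-dependent generators, started at $x$ at time $s$, is at $y$ at time $t$ (so $\partial_tP_{s,t}=P_{s,t}M_{2,t}$, $P_{s,s}=I$). $U_{min}=\{x: U(x)=\min_yU(y)\}$; $\pi_{min}(x)=\pi(x)/\pi(U_{min})$ for $x\in U_{min}$ and $\pi_{min}(x)=0$ otherwise. $\|\mu-\nu\|_{TV}=\frac12\sum_x|\mu(x)-\nu(x)|$. A path from $x$ to $y$ is a sequence $\gamma=(\gamma_i)_{i=0}^n$ with $\gamma_0=x$, $\gamma_n=y$ and $Q(\gamma_{i-1},\gamma_i)>0$ for $i=1,\ldots,n$; $\Gamma^{x,y}$ is the set of such paths. $\mathrm{Elev}_2(\gamma)=\max_{1\le i\le n}\min\{U(\gamma_{i-1}),U(\gamma_i)\}$, $H_2(x,y)=\min_{\gamma\in\Gamma^{x,y}}\mathrm{Elev}_2(\gamma)$, and $c_{M_2}=\max_{x\neq y}\{H_2(x,y)-U(x)-U(y)\}$.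 *)

(* Defs.v *)
From HB Require Import structures.
From mathcomp Require Import all_boot all_order all_algebra.
From mathcomp Require Import all_classical all_reals all_analysis.

Set Implicit Arguments.
Unset Strict Implicit.
Unset Printing Implicit Defensive.

Import Order.TTheory GRing.Theory Num.Theory.
Import numFieldNormedType.Exports.

Local Open Scope classical_set_scope.
Local Open Scope ring_scope.

(* Maxima and minima over finite nonempty sets of reals are written with
   [sup] and [inf], which coincide with them there. *)

Section Chain.
Context {R : realType} {X : finType}.
Implicit Types (Q : X -> X -> R) (U pi mu nu : X -> R) (T : R -> R)
  (P : R -> R -> X -> X -> R).

Definition is_generator Q : Prop :=
  (forall x y, x != y -> 0 <= Q x y) /\ (forall x, \sum_y Q x y = 0).

(* The sequence gamma_0, ..., gamma_n is represented by x = gamma_0 and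
   p = [:: gamma_1; ...; gamma_n]. *)
Definition is_path Q (x y : X) (p : seq X) : Prop :=
  path (fun a b => 0 < Q a b) x p /\ last x p = y.

(* On a finite state space, ergodicity of a continuous-time chain is
   irreducibility. *)
Definition ergodic_generator Q : Prop :=
  is_generator Q /\ (forall x y, exists p, is_path Q x y p).

Definition is_distribution mu : Prop :=
  (forall x, 0 <= mu x) /\ \sum_x mu x = 1.

Definition stationary Q pi : Prop :=
  is_distribution pi /\ (forall y, \sum_x pi x * Q x y = 0).

Definition reversible Q pi : Prop :=
  forall x y, pi x * Q x y = pi y * Q y x.

(* Meaningful for n >= 1 only, which is the case when the ends differ. *)
Definition Elev2 U (x : X) (p : seq X) : R :=
  sup [set Num.min (U (nth x (x :: p) i.-1)) (U (nth x (x :: p) i))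
      | i in [set i | (1 <= i <= size p)%N]].

Definition H2 U Q (x y : X) : R :=
  inf [set Elev2 U x p | p in [set p | is_path Q x y p]].

Definition c_M2 U Q : R :=
  sup [set H2 U Q xy.1 xy.2 - U xy.1 - U xy.2
      | xy in [set xy : X * X | xy.1 != xy.2]].

Definition blows_up_at0 T : Prop := T u @[u --> 0^'+] --> +oo.

(* The value [T 0] is disregarded when the schedule blows up at 0. *)
Definition schedule_domain T : set R :=
  [set t | 0 < t \/ (t = 0 /\ ~ blows_up_at0 T)].

Definition cooling_schedule T : Prop :=
  [/\ forall t, schedule_domain T t -> 0 < T t,
      forall (s t : R), schedule_domain T s -> schedule_domain T t ->
        s <= t -> T t <= T s
    & T t @[t --> +oo] --> 0].

Definition differentiable_schedule T : Prop :=
  forall t : R, 0 < t -> derivable T t 1.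

Definition inv_temp T (t : R) : R :=
  if (t == 0) && `[< blows_up_at0 T >] then 0 else (T t)^-1.

Definition M2_off U Q T (t : R) (x y : X) : R :=
  Q x y * Num.max 1 (expR ((U x - U y) * inv_temp T t)).

Definition M2 U Q T (t : R) (x y : X) : R :=
  if x == y then - \sum_(z | z != x) M2_off U Q T t x z
  else M2_off U Q T t x y.

(* At the initial time t = s the forward equation is replaced by right
   continuity. *)
Definition transition_semigroup (M : R -> X -> X -> R) P : Prop :=
  [/\ forall (s t : R) x, 0 <= s -> s <= t -> is_distribution (P s t x),
      forall (s : R) x y, 0 <= s -> P s s x y = (x == y)%:R,
      forall (s u t : R) x y, 0 <= s -> s <= u -> u <= t ->
        P s t x y = \sum_z P s u x z * P u t z y,
      forall (s : R) x y, 0 <= s -> P s t x y @[t --> s^'+] --> P s s x y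
    & forall (s t : R) x y, 0 <= s -> s < t ->
        is_derive t 1 (fun u : R => P s u x y) (\sum_z P s t x z * M t z y)].

Definition in_Umin U (x : X) : bool := [forall y, U x <= U y].

Definition pi_min U pi (x : X) : R :=
  if in_Umin U x then pi x / \sum_(y | in_Umin U y) pi y else 0.

Definition tv_dist mu nu : R := 2^-1 * \sum_x `|mu x - nu x|.

Definition converges_tv P mu : Prop :=
  forall s : R, 0 <= s ->
    sup [set tv_dist (P s t x) mu | x in [set: X]] @[t --> +oo] --> 0.

Definition strongly_ergodic P : Prop :=
  exists2 mu, is_distribution mu & converges_tv P mu.

End Chain.

Section Schedules.
Context {R : realType}.

Definition cooling_condition (c : R) (T : R -> R) : Prop :=
  derive1 T t * (expR (c / T t) / T t ^+ 2) @[t --> +oo] --> 0.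

Definition admissible_schedule (c : R) (T : R -> R) : Prop :=
  [/\ cooling_schedule T, differentiable_schedule T & cooling_condition c T].

Definition sched_pow (a t : R) : R := (t + 1) `^ (- a).
Definition sched_log (k t : R) : R := ln (t + 1) `^ (- k).
Definition sched_powlog (a t : R) : R := (t + 1) `^ (- a) * (ln (t + 1))^-1.
Definition sched_exp (t : R) : R := expR (- t).

Definition below_log (T : R -> R) : Prop :=
  T t * ln (t + 1) @[t --> +oo] --> 0.

End Schedules.

(* Main.v *)
Require Import Defs.
From HB Require Import structures.
From mathcomp Require Import all_boot all_order all_algebra.
From mathcomp Require Import all_classical all_reals all_analysis.
From mathcomp Require Import ring lra.

(** The chain at time t is reversible for the Gibbs measure g_b proportional
    to pi(x) e^(-b U(x)), where b = 1/T(t), and its conductance along the edge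
    (x, y) is proportional to pi(x) Q(x,y) e^(-b min(U(x), U(y))).  Joining two
    states by a path of least elevation and comparing the increment of a
    function along that path with its Dirichlet form gives a Poincare
    inequality whose constant is at least C e^(-b c), with c = c_M2
    ([poincare]).  Since c <= 0, the spectral gap never falls below C.

    Let F(t) be the chi-square divergence from g_b(t) of the law of the chain
    at time t.  The dynamics dissipates it at rate at least 2 C e^(-b c) F
    ([chi2_dissipation]), while the motion of the target g_b(t) feeds it at
    rate at most |b'| M (F + 1), with M bounding the oscillation of U
    ([dchi2_le]).  As b' = - T' / T^2, the cooling condition says exactly that
    |b'| is negligible compared to e^(-b c), hence to the gap.  So, for every
    e > 0, eventually F' <= - l (F - e) with l >= C, which forces F to 0
    ([relaxation_cvg]).  Finally g_b converges to pi_min pointwise as b tends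
    to infinity, and on a finite set pointwise convergence gives convergence
    in total variation, uniformly in the starting point.

    For the schedules, write T = 1/g.  The quantity in the cooling condition
    is - g' e^(c g): as c <= 0, it is enough that g' tends to 0, and if
    c < 0 the exponential beats any g' dominated by a multiple of g
    ([admissible_inv]). *)

Import Order.TTheory GRing.Theory Num.Theory.
Import numFieldNormedType.Exports.

Local Open Scope classical_set_scope.
Local Open Scope ring_scope.

(** * Paths, elevations and the critical height *)

Section Paths.
Set Implicit Arguments.
Unset Strict Implicit.
Context {R : realType} {X : finType}.
Implicit Types (U f : X -> R) (Q : X -> X -> R).

Lemma ler_sum_norm (I : finType) (f : I -> R) i : f i <= \sum_j `|f j|.
Proof.
by rewrite (bigD1 i)//= (le_trans (ler_norm _))// lerDl sumr_ge0.
Qed.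

Lemma has_ubound_image (I : finType) (f : I -> R) (A : set I) :
  has_ubound (f @` A).
Proof. by exists (\sum_i `|f i|) => _ [i _ <-]; exact: ler_sum_norm. Qed.

Lemma min_edge_le_Elev2 U x p i : (1 <= i <= size p)%N ->
  Num.min (U (nth x (x :: p) i.-1)) (U (nth x (x :: p) i)) <= Elev2 U x p.
Proof.
move=> ip; apply: ub_le_sup; last by exists i.
exists (\sum_z `|U z|) => _ [j _ <-].
by rewrite (le_trans _ (ler_sum_norm U (nth x (x :: p) j)))// ge_min lexx orbT.
Qed.

Lemma Elev2_attained U x p : (0 < size p)%N ->
  exists ab : X * X, Elev2 U x p = Num.min (U ab.1) (U ab.2).
Proof.
move=> p0; pose F (i : 'I_(size p)) : R :=
  Num.min (U (nth x (x :: p) i)) (U (nth x (x :: p) i.+1)).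
case: (@arg_maxP _ _ _ (Ordinal p0) predT F isT) => i _ iF.
exists (nth x (x :: p) i, nth x (x :: p) i.+1).
apply/eqP; rewrite eq_le; apply/andP; split.
  apply: ge_sup; first by exists (F (Ordinal p0)), 1%N.
  by move=> _ [[//|j] /= jp <-]; exact: (iF (Ordinal jp) isT).
exact: (@min_edge_le_Elev2 U x p i.+1 (ltn_ord i)).
Qed.

(** A path of least elevation exists although there are infinitely many paths:
    elevations take finitely many values, the minima of U over pairs of states.
    Attainment matters, since a loss of any d > 0 in the elevation would cost
    a factor e^(b d), which is unbounded in b. *)
Lemma H2_attained U Q x y : ergodic_generator Q -> x != y ->
  exists2 p, is_path Q x y p & Elev2 U x p <= H2 U Q x y.
Proof.
move=> [_ irrQ] xy.
have path_gt0 p : is_path Q x y p -> (0 < size p)%N.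
  by case: p => //= -[_ /= xy0]; rewrite xy0 eqxx in xy.
pose F (ab : X * X) := Num.min (U ab.1) (U ab.2).
pose A (ab : X * X) := `[< exists2 p, is_path Q x y p & Elev2 U x p = F ab >].
have [p0 xp0] := irrQ x y.
have [ab0 ab0E] := Elev2_attained U x (path_gt0 _ xp0).
have Aab0 : A ab0 by apply/asboolP; exists p0.
case: (@arg_minP _ _ _ ab0 A F Aab0) => ab /asboolP[p xp pE] Fmin.
exists p => //; apply: lb_le_inf; first by exists (Elev2 U x p0), p0.
move=> _ [q xq <-]; have [cd cdE] := Elev2_attained U x (path_gt0 _ xq).
by rewrite pE cdE; apply: Fmin; apply/asboolP; exists q.
Qed.

Lemma H2_le_c_M2 U Q x y : x != y -> H2 U Q x y - U x - U y <= c_M2 U Q.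
Proof.
by move=> xy; apply: ub_le_sup; [exact: has_ubound_image|exists (x, y)].
Qed.

Lemma path_increment_le f (K : R) x p :
  (forall i, (i < size p)%N ->
     `|f (nth x (x :: p) i) - f (nth x (x :: p) i.+1)| <= K) ->
  `|f x - f (last x p)| <= (size p)%:R * K.
Proof.
elim: p x => [|a p IH] x /= H; first by rewrite subrr normr0 mul0r.
have {}IH : `|f a - f (last a p)| <= (size p)%:R * K.
  apply: IH => i ip; have := H i.+1 ip.
  by rewrite /= (set_nth_default x a) 1?(set_nth_default x a) //= ltnW.
rewrite -(subrKA (f a)) (le_trans (ler_normD _ _))// -[(size p).+1]add1n.
by rewrite natrD mulrDl mul1r lerD// (H 0%N).
Qed.

End Paths.

(** * The Poincare inequality *)

Section Poincare.
Set Implicit Arguments.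
Unset Strict Implicit.
Context {R : realType} {X : finType}.
Implicit Types (U f pi : X -> R) (Q : X -> X -> R).

Definition weight U pi (b : R) (x : X) : R := pi x * expR (- (b * U x)).

(** The product of [weight] and the rate [M2] off the diagonal, see
    [weight_M2]. *)
Definition conductance U Q pi (b : R) (x y : X) : R :=
  pi x * Q x y * expR (- (b * Num.min (U x) (U y))).

(** Up to the factor 2 and the normalisation of the Gibbs measure, the
    Dirichlet form of the chain. *)
Definition dirichlet U Q pi b f : R :=
  \sum_x \sum_y conductance U Q pi b x y * (f x - f y) ^+ 2.

(** Reversibility carries positivity of pi across each edge: if
    Q x y > 0 then pi y * Q y x = pi x * Q x y > 0. *)
Lemma stationary_gt0 Q pi : ergodic_generator Q -> stationary Q pi ->
  reversible Q pi -> forall x, 0 < pi x.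
Proof.
move=> [[Q0 _] irrQ] [[pi0 pi1] _] rev y.
have [x pix] : exists x, 0 < pi x.
  apply/existsP; apply: contraTT isT => /existsPn pile0.
  have /eqP := pi1; rewrite big1 ?(eq_sym 0) ?oner_eq0// => x _.
  by apply/eqP; rewrite eq_le pi0 andbT leNgt.
have [p [xp <-]] := irrQ x y.
elim: p x pix xp => //= a p IH x pix /andP[Qxa ap]; apply: IH ap.
rewrite lt_neqAle pi0 andbT; apply: contraTneq Qxa => pia.
have := rev x a; rewrite -pia mul0r => /eqP; rewrite mulf_eq0 gt_eqF//=.
by move=> /eqP ->; rewrite ltxx.
Qed.

Section Conductances.
Variables (U : X -> R) (Q : X -> X -> R) (pi : X -> R).
Hypotheses (hQ : ergodic_generator Q) (hpi : stationary Q pi)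
  (hrev : reversible Q pi).

Let pi_gt0 := stationary_gt0 hQ hpi hrev.

Lemma dirichlet_term_ge0 b f x y :
  0 <= conductance U Q pi b x y * (f x - f y) ^+ 2.
Proof.
have [->|xy] := eqVneq x y; first by rewrite subrr expr0n/= mulr0.
have [[Q0 _] _] := hQ.
apply: mulr_ge0; last exact: sqr_ge0.
by rewrite !mulr_ge0 ?expR_ge0 ?Q0 ?ltW.
Qed.

Lemma dirichlet_ge0 b f : 0 <= dirichlet U Q pi b f.
Proof. by do 2!apply: sumr_ge0 => ? _; exact: dirichlet_term_ge0. Qed.

Lemma dirichlet_term_le b f x y :
  conductance U Q pi b x y * (f x - f y) ^+ 2 <= dirichlet U Q pi b f.
Proof.
rewrite /dirichlet (bigD1 x)//= (bigD1 y)//= -addrA lerDl addr_ge0//.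
  by apply: sumr_ge0 => ? _; exact: dirichlet_term_ge0.
by do 2!apply: sumr_ge0 => ? _; exact: dirichlet_term_ge0.
Qed.

Lemma edge_increment_le x y : 0 < Q x y -> forall b f,
  (f x - f y) ^+ 2 <=
    (pi x * Q x y)^-1 * expR (b * Num.min (U x) (U y)) * dirichlet U Q pi b f.
Proof.
move=> Qxy b f.
have pQ : 0 < pi x * Q x y by rewrite mulr_gt0.
have := dirichlet_term_le b f x y.
rewrite /conductance -mulrA -ler_pdivlMl//.
rewrite expRN -ler_pdivlMl ?invr_gt0 ?expR_gt0// invrK.
by rewrite mulrA (mulrC (expR _)).
Qed.

(** Along an optimal path each edge has minimum at most H2, so each increment
    of f is controlled by the Dirichlet form with the same factor
    e^(b H2). *)
Lemma pair_increment_le x y : x != y ->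
  exists2 K, 0 <= K & forall (b : R) f, 0 <= b ->
    (f x - f y) ^+ 2 <= K * expR (b * H2 U Q x y) * dirichlet U Q pi b f.
Proof.
move=> xy; have [p [xp <-] pH] := H2_attained U hQ xy.
move: pH; set H := H2 _ _ _ _ => pH.
(* k dominates the inverse of pi a * Q a c for every edge (a, c). *)
pose k := \sum_a \sum_c `|(pi a * Q a c)^-1|.
have k0 : 0 <= k by do 2!apply: sumr_ge0 => ? _.
exists ((size p)%:R ^+ 2 * k) => [|b f b0]; first by rewrite mulr_ge0 ?sqr_ge0.
have B0 : 0 <= k * expR (b * H) * dirichlet U Q pi b f.
  by rewrite !mulr_ge0 ?expR_ge0 ?dirichlet_ge0.
rewrite [leRHS](_ : _ = ((size p)%:R *
    Num.sqrt (k * expR (b * H) * dirichlet U Q pi b f)) ^+ 2); last first.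
  by rewrite exprMn sqr_sqrtr//; ring.
rewrite -[leLHS]real_normK ?num_real//; apply: lerXn2r.
- by rewrite nnegrE.
- by rewrite nnegrE mulr_ge0 ?sqrtr_ge0.
apply: path_increment_le => i ip.
rewrite -sqrtr_sqr ler_wsqrtr//.
have Qe : 0 < Q (nth x (x :: p) i) (nth x (x :: p) i.+1).
  by move/(pathP x): xp => /(_ i ip).
apply: (le_trans (edge_increment_le Qe b f)).
apply: ler_wpM2r; first exact: dirichlet_ge0.
apply: ler_pM; rewrite ?expR_ge0//.
- by rewrite invr_ge0 mulr_ge0 ?ltW.
- rewrite (le_trans (ler_norm _))// /k (bigD1 (nth x (x :: p) i))//=.
  rewrite (bigD1 (nth x p i))//= -addrA lerDl addr_ge0 ?sumr_ge0// => a _.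
  exact: sumr_ge0.
- rewrite ler_expR ler_wpM2l// (le_trans _ pH)//.
  exact: (@min_edge_le_Elev2 _ _ U x p i.+1 ip).
Qed.

Lemma weighted_pair_le x y :
  exists2 K, 0 <= K & forall (b : R) f, 0 <= b ->
    weight U pi b x * weight U pi b y * (f x - f y) ^+ 2 <=
      K * expR (b * c_M2 U Q) * dirichlet U Q pi b f.
Proof.
have [->|xy] := eqVneq x y.
  by exists 0 => // b f _; rewrite subrr expr0n/= mulr0 !mul0r.
have [K K0 Kle] := pair_increment_le xy.
have pxy : 0 <= pi x * pi y by rewrite mulr_ge0 ?ltW.
exists (pi x * pi y * K) => [|b f b0]; first by rewrite mulr_ge0.
have w0 : 0 <= weight U pi b x * weight U pi b y.
  by rewrite !mulr_ge0 ?expR_ge0 ?ltW.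
apply: (le_trans (ler_wpM2l w0 (Kle b f b0))).
rewrite mulrA ler_wpM2r ?dirichlet_ge0//.
rewrite /weight [leLHS](_ : _ = pi x * pi y * K *
    (expR (- (b * U x)) * expR (- (b * U y)) * expR (b * H2 U Q x y)));
  last by ring.
apply: ler_wpM2l; first by rewrite mulr_ge0.
rewrite -!expRD ler_expR.
rewrite [leLHS](_ : _ = b * (H2 U Q x y - U x - U y)); last by ring.
by rewrite ler_wpM2l// H2_le_c_M2.
Qed.

(** The weights of x and y contribute e^(- b (U x + U y)), which turns the
    factor e^(b H2) of each pair into at most e^(b c_M2).  A state of energy 0
    keeps the total weight bounded below, so C does not depend on b. *)
Lemma poincare x0 : U x0 = 0 ->
  exists2 C, 0 < C & forall (b : R) f, 0 <= b ->
    C * expR (- (b * c_M2 U Q)) *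
      \sum_x \sum_y weight U pi b x * weight U pi b y * (f x - f y) ^+ 2
    <= (\sum_x weight U pi b x) * dirichlet U Q pi b f.
Proof.
move=> Ux0.
have /choice[K HK] : forall xy : X * X, exists K : R, 0 <= K /\
    forall (b : R) f, 0 <= b ->
    weight U pi b xy.1 * weight U pi b xy.2 * (f xy.1 - f xy.2) ^+ 2 <=
      K * expR (b * c_M2 U Q) * dirichlet U Q pi b f.
  by move=> [x y]; have [k k0 kle] := weighted_pair_le x y; exists k.
pose S := 1 + \sum_x \sum_y K (x, y).
have S0 : 0 < S.
  rewrite ltr_pwDl//; apply: sumr_ge0 => x _; apply: sumr_ge0 => y _.
  by have [] := HK (x, y).
exists (pi x0 / S) => [|b f b0]; first by rewrite divr_gt0.
have D0 := dirichlet_ge0 b f.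
have Zge : pi x0 <= \sum_x weight U pi b x.
  rewrite (bigD1 x0)//= {1}/weight Ux0 mulr0 oppr0 expR0 mulr1 lerDl.
  by apply: sumr_ge0 => z _; rewrite mulr_ge0 ?expR_ge0 ?ltW.
apply: le_trans (ler_wpM2r D0 Zge).
rewrite -!mulrA; apply: ler_wpM2l; first exact: ltW.
rewrite ler_pdivrMl// expRN ler_pdivrMl ?expR_gt0//.
apply: (@le_trans _ _ ((\sum_x \sum_y K (x, y)) *
    (expR (b * c_M2 U Q) * dirichlet U Q pi b f))).
  rewrite mulr_suml ler_sum// => x _; rewrite mulr_suml ler_sum// => y _.
  by have [_ /(_ b f b0)] := HK (x, y); rewrite mulrA.
rewrite [leRHS]mulrCA; apply: ler_wpM2r; first by rewrite mulr_ge0 ?expR_ge0.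
by rewrite /S lerDr.
Qed.

End Conductances.
End Poincare.

(** * The chi-square divergence from the Gibbs measure *)

Section ChiSquare.
Set Implicit Arguments.
Unset Strict Implicit.
Context {R : realType} {X : finType}.
Implicit Types (U f pi mu : X -> R) (Q A : X -> X -> R).

Definition gibbs U pi (b : R) (x : X) : R :=
  weight U pi b x / \sum_z weight U pi b z.

(** The reciprocal of [gibbs], by [inv_gibbsE], as a sum of exponentials of
    energy differences: in this form its logarithmic derivative in b is
    visibly bounded by the oscillation of U. *)
Definition inv_gibbs U pi (b : R) (x : X) : R :=
  \sum_z pi z / pi x * expR (b * (U x - U z)).

Definition chi2 U pi b mu : R := \sum_x mu x ^+ 2 * inv_gibbs U pi b x - 1.

Lemma sum_pairs_sqr_sub (w f : X -> R) :
  \sum_x \sum_y w x * w y * (f x - f y) ^+ 2 =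
    2 * ((\sum_x w x) * (\sum_x w x * f x ^+ 2) - (\sum_x w x * f x) ^+ 2).
Proof.
transitivity (\sum_x \sum_y (w x * f x ^+ 2 * w y + w x * (w y * f y ^+ 2)
    - 2 * ((w x * f x) * (w y * f y)))).
  by apply: eq_bigr => x _; apply: eq_bigr => y _; ring.
under eq_bigr do rewrite sumrB big_split/= -!mulr_sumr.
rewrite sumrB big_split/= -mulr_sumr -!mulr_suml; ring.
Qed.

Lemma sum_generator_form A f : (forall x y, A x y = A y x) ->
    (forall x, \sum_y A x y = 0) ->
  \sum_y f y * \sum_z f z * A z y
    = - (2^-1 * \sum_x \sum_y A x y * (f x - f y) ^+ 2).
Proof.
move=> Asym A0.
have -> : \sum_y f y * (\sum_z f z * A z y) = \sum_x \sum_y f x * f y * A x y.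
  apply: eq_bigr => x _; rewrite mulr_sumr; apply: eq_bigr => y _.
  by rewrite (Asym y x) mulrA.
have S1 : \sum_x \sum_y A x y * f x ^+ 2 = 0.
  by apply: big1 => x _; rewrite -mulr_suml A0 mul0r.
have S2 : \sum_x \sum_y A x y * f y ^+ 2 = 0.
  rewrite exchange_big/=; apply: big1 => x _.
  by under eq_bigr do rewrite Asym; rewrite -mulr_suml A0 mul0r.
have -> : \sum_x \sum_y A x y * (f x - f y) ^+ 2 =
    \sum_x \sum_y A x y * f x ^+ 2 + \sum_x \sum_y A x y * f y ^+ 2
    - 2 * \sum_x \sum_y f x * f y * A x y.
  rewrite mulr_sumr -big_split -sumrB/=; apply: eq_bigr => x _.
  rewrite mulr_sumr -big_split -sumrB/=; apply: eq_bigr => y _; ring.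
by rewrite S1 S2 !add0r mulrN mulKf ?opprK// pnatr_eq0.
Qed.

Section PositiveMeasure.
Variables (U pi : X -> R).
Hypotheses (pi_gt0 : forall x, 0 < pi x) (pi1 : \sum_x pi x = 1).

Lemma weight_gt0 b x : 0 < weight U pi b x.
Proof. by rewrite mulr_gt0 ?expR_gt0. Qed.

Lemma sum_weight_gt0 b : 0 < \sum_x weight U pi b x.
Proof.
rewrite lt_neqAle sumr_ge0 ?andbT => [|x _]; last exact/ltW/weight_gt0.
rewrite eq_sym psumr_neq0 => [|x _]; last exact/ltW/weight_gt0.
apply: contraPT pi1 => /hasPn no.
rewrite big1 => [|x _]; first by move/eqP; rewrite eq_sym oner_eq0.
by have := no x (mem_index_enum x); rewrite weight_gt0.
Qed.

Lemma gibbs_gt0 b x : 0 < gibbs U pi b x.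
Proof. by rewrite divr_gt0 ?weight_gt0 ?sum_weight_gt0. Qed.

Lemma sum_gibbs b : \sum_x gibbs U pi b x = 1.
Proof. by rewrite -mulr_suml divff// gt_eqF ?sum_weight_gt0. Qed.

Lemma gibbs_le1 b x : gibbs U pi b x <= 1.
Proof.
rewrite -(sum_gibbs b) (bigD1 x)//= lerDl sumr_ge0// => y _.
exact/ltW/gibbs_gt0.
Qed.

Lemma inv_gibbsE b x : inv_gibbs U pi b x = (gibbs U pi b x)^-1.
Proof.
rewrite /gibbs invf_div mulr_suml; apply: eq_bigr => z _.
rewrite /weight invfM -expRN opprK mulrACA -expRD; congr (_ * expR _); ring.
Qed.

Lemma chi2E b mu : \sum_x mu x = 1 ->
  chi2 U pi b mu = \sum_x (mu x - gibbs U pi b x) ^+ 2 / gibbs U pi b x.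
Proof.
move=> mu1.
transitivity
  (\sum_x (mu x ^+ 2 * inv_gibbs U pi b x - 2 * mu x + gibbs U pi b x)).
  by rewrite big_split/= sumrB -mulr_sumr mu1 sum_gibbs /chi2; ring.
apply: eq_bigr => x _; rewrite inv_gibbsE; field.
by rewrite gt_eqF// gibbs_gt0.
Qed.

(** One term of the sum in [chi2E], whose denominator is at most 1. *)
Lemma sqr_sub_gibbs_le_chi2 b mu x : \sum_x mu x = 1 ->
  (mu x - gibbs U pi b x) ^+ 2 <= chi2 U pi b mu.
Proof.
move=> mu1; rewrite chi2E// (bigD1 x)//=.
have t0 y : 0 <= (mu y - gibbs U pi b y) ^+ 2 / gibbs U pi b y.
  by rewrite divr_ge0 ?sqr_ge0// ltW// gibbs_gt0.
rewrite (@le_trans _ _ ((mu x - gibbs U pi b x) ^+ 2 / gibbs U pi b x))//.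
  by rewrite ler_pdivlMr ?gibbs_gt0// ler_piMr ?sqr_ge0// gibbs_le1.
by rewrite lerDl sumr_ge0.
Qed.

End PositiveMeasure.

Lemma chi2_ge0 U pi b mu : (forall x, 0 < pi x) -> \sum_x pi x = 1 ->
  \sum_x mu x = 1 -> 0 <= chi2 U pi b mu.
Proof.
move=> pi_gt0 pi1 mu1; rewrite chi2E//; apply: sumr_ge0 => x _.
by rewrite divr_ge0 ?sqr_ge0// ltW// gibbs_gt0.
Qed.

Lemma sum_M2 U Q T t x : \sum_y M2 U Q T t x y = 0.
Proof.
rewrite (bigD1 x)//= {1}/M2 eqxx; apply/eqP; rewrite addrC subr_eq0; apply/eqP.
by apply: eq_bigr => y yx; rewrite /M2 eq_sym (negbTE yx).
Qed.

(** Detailed balance: the acceleration factor e^(b (U x - U y)_+) of the rate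
    turns the Boltzmann factor of x into that of the lower of x and y, which
    is symmetric in x and y. *)
Lemma weight_M2 U Q pi T t x y : 0 <= inv_temp T t -> x != y ->
  weight U pi (inv_temp T t) x * M2 U Q T t x y =
  conductance U Q pi (inv_temp T t) x y.
Proof.
move=> b0 xy; rewrite /M2 (negbTE xy) /M2_off /weight /conductance.
move: (inv_temp T t) b0 => b b0.
have [Uxy|Uyx] := leP (U x) (U y).
  rewrite max_l; last by rewrite -expR0 ler_expR mulr_le0_ge0// subr_le0.
  ring.
rewrite max_r; last by rewrite -[leLHS]expR0 ler_expR mulr_ge0// subr_ge0 ltW.
by rewrite mulrACA -expRD; congr (_ * expR _); ring.
Qed.

(** The Poincare inequality for the density f = mu / gibbs, whose variance is
    the chi-square divergence of mu; the right-hand side is the Dirichlet form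
    of f, that is, minus half the rate of change of the divergence when the
    Gibbs measure is kept fixed. *)
Lemma chi2_dissipation U Q pi x0 : ergodic_generator Q -> stationary Q pi ->
    reversible Q pi -> U x0 = 0 ->
  exists2 C, 0 < C & forall T t mu, 0 <= inv_temp T t -> \sum_x mu x = 1 ->
    C * expR (- (inv_temp T t * c_M2 U Q)) * chi2 U pi (inv_temp T t) mu
    <= - \sum_y mu y * inv_gibbs U pi (inv_temp T t) y *
         \sum_z mu z * M2 U Q T t z y.
Proof.
move=> hQ hpi hrev Ux0; have pi_gt0 := stationary_gt0 hQ hpi hrev.
have pi1 : \sum_x pi x = 1 by case: hpi => -[].
have [C C0 HC] := poincare hQ hpi hrev Ux0.
exists C => // T t mu b0 mu1; set b := inv_temp T t.
set Z := \sum_x weight U pi b x.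
have Z0 : 0 < Z by exact: sum_weight_gt0.
have w0 x : weight U pi b x != 0 by rewrite gt_eqF// weight_gt0.
pose f x := mu x * inv_gibbs U pi b x.
have fE x : f x = mu x * Z / weight U pi b x.
  by rewrite /f inv_gibbsE// /gibbs invf_div mulrA.
have wf x : weight U pi b x * f x = Z * mu x by rewrite fE; field; exact: w0.
have := HC b f b0; rewrite sum_pairs_sqr_sub -/Z.
have -> : \sum_x weight U pi b x * f x = Z.
  by under eq_bigr do rewrite wf; rewrite -mulr_sumr mu1 mulr1.
have -> : \sum_x weight U pi b x * f x ^+ 2 = Z * (chi2 U pi b mu + 1).
  rewrite /chi2 subrK mulr_sumr; apply: eq_bigr => x _.
  by rewrite expr2 mulrA wf /f; ring.
pose A x y := weight U pi b x * M2 U Q T t x y.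
have -> : dirichlet U Q pi b f = \sum_x \sum_y A x y * (f x - f y) ^+ 2.
  apply: eq_bigr => x _; apply: eq_bigr => y _.
  have [->|xy] := eqVneq x y; first by rewrite subrr expr0n/= !mulr0.
  by rewrite /A weight_M2.
have Asym x y : A x y = A y x.
  have [->//|xy] := eqVneq x y.
  by rewrite /A !weight_M2// 1?eq_sym// /conductance hrev minC.
have A0 x : \sum_y A x y = 0 by rewrite -mulr_sumr sum_M2 mulr0.
have := sum_generator_form f Asym A0.
have -> : \sum_y f y * (\sum_z f z * A z y) =
    Z * \sum_y mu y * inv_gibbs U pi b y * \sum_z mu z * M2 U Q T t z y.
  rewrite mulr_sumr; apply: eq_bigr => y _; rewrite -/(f y) mulrCA.
  congr (_ * _); rewrite mulr_sumr; apply: eq_bigr => z _.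
  by rewrite /A mulrA (mulrC (f z)) wf; ring.
set S := (X in Z * X); set D := \sum_x \sum_y A x y * _ => DE le.
have {DE} DE : D = - (2 * Z * S).
  by rewrite -mulrA DE mulrN opprK mulVKf// pnatr_eq0.
rewrite -(ler_pM2l (_ : 0 < 2 * Z ^+ 2)); last by rewrite mulr_gt0// exprn_gt0.
apply: le_trans (_ : Z * D <= _); last first.
  by rewrite DE -/S [leLHS](_ : _ = 2 * Z ^+ 2 * - S)//; ring.
by apply: le_trans le; rewrite [leRHS](_ : _ = 2 * Z ^+ 2 *
    (C * expR (- (b * c_M2 U Q)) * chi2 U pi b mu))//; ring.
Qed.

End ChiSquare.

(** * Relaxation of a differential inequality *)

Section Gronwall.
Set Implicit Arguments.
Unset Strict Implicit.
Context {R : realType}.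
Implicit Types (F dF D dD l : R -> R) (a b K C e : R).

Lemma is_derive_continuous (f : R -> R) (x df : R) :
  is_derive x 1 f df -> {for x, continuous f}.
Proof.
by move=> fx; apply/differentiable_continuous/derivable1_diffP/ex_derive.
Qed.

(** After the last time s at which D <= K the derivative is nonpositive, so by
    the mean value theorem D cannot rise above D s. *)
Lemma derivative_barrier D dD a b K : a <= b ->
    (forall t, a <= t <= b -> is_derive t 1 D (dD t)) ->
    (forall t, a <= t <= b -> K < D t -> dD t <= 0) ->
  D a <= K -> D b <= K.
Proof.
move=> ab dvD dD0 DaK; rewrite leNgt; apply/negP => KDb.
pose S := [set t | a <= t <= b /\ D t <= K].
have Sa : S a by split=> //; rewrite lexx.
have Sub : ubound S b by move=> t [/andP[]].
have supS : has_sup S by split; [exists a|exists b].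
pose s := sup S.
have as_ : a <= s by apply: ub_le_sup Sa; exists b.
have sb : s <= b by apply: ge_sup => //; exists a.
have asb : a <= s <= b by rewrite as_.
have DsK : D s <= K.
  rewrite leNgt; apply/negP => KDs.
  have := is_derive_continuous (dvD _ asb).
  move/cvgr_gt => /(_ _ KDs) [d /= d0 dD_].
  have [t St dt] := sup_adherent d0 supS.
  have ts : t <= s by apply: ub_le_sup St; exists b.
  have := dD_ t; rewrite /= ger0_norm ?subr_ge0// ltrBlDl -ltrBlDr => /(_ dt).
  by rewrite ltNge; case: St => _ ->.
have {}sb : s < b.
  by rewrite lt_neqAle sb andbT; apply: contraTneq KDb => <-; rewrite -leNgt.
have inab t : t \in `[s, b] -> a <= t <= b.
  by rewrite in_itv/= => /andP[st ->]; rewrite (le_trans as_).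
have [|//||t] := @MVT R D dD s b.
- exact: sb.
- by move=> t /subset_itv_oo_cc tsb; apply: dvD; exact: inab.
- apply: derivable_within_continuous => t tsb.
  by have := dvD _ (inab _ tsb) => ?; exact: ex_derive.
move=> tsb DE.
have stb := inab _ (subset_itv_oo_cc tsb).
have KDt : K < D t.
  rewrite ltNge; apply/negP => DtK; move: tsb; rewrite in_itv/= ltNge.
  by have -> : t <= s by apply: ub_le_sup; [exists b|].
have : dD t * (b - s) <= 0.
  by rewrite mulr_le0_ge0 ?dD0// subr_ge0 ltW.
by rewrite -DE subr_le0 leNgt (le_lt_trans DsK).
Qed.

(** The function e^(C (t - a)) (F t - e) cannot increase while F t > e.  The
    sign restriction is needed because the inequality C <= l may be
    multiplied by F t - e only then, and it is why a barrier is used. *)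
Lemma relaxation F dF l a C e : 0 <= e -> 0 <= F a ->
    (forall t, a <= t -> is_derive t 1 F (dF t)) ->
    (forall t, a <= t -> C <= l t /\ dF t <= - l t * (F t - e)) ->
  forall t, a <= t -> F t <= e + F a * expR (- (C * (t - a))).
Proof.
move=> e0 Fa0 dvF dFle b ab.
pose D (t : R) := expR (C * (t - a)) * (F t - e).
pose dD (t : R) := expR (C * (t - a)) * (dF t + C * (F t - e)).
suff : D b <= F a.
  by rewrite expRN -lerBlDl ler_pdivlMr ?expR_gt0// mulrC.
apply: (@derivative_barrier D dD a b) => //.
- move=> t /andP[at_ _]; have dFt := dvF t at_.
  have dE : is_derive t 1 (fun u : R => expR (C * (u - a)))
      (expR (C * (t - a)) * C).
    apply: (@is_derive1_comp R expR (fun u => C * (u - a))).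
    by apply: is_derive_eq; rewrite /GRing.scale/= subr0 mulr1.
  apply: is_derive_eq; rewrite /GRing.scale/= /dD subr0; ring.
- move=> t /andP[at_ _] Dt.
  have Ft : 0 < F t - e.
    by rewrite -(pmulr_rgt0 _ (expR_gt0 (C * (t - a)))) (le_lt_trans Fa0).
  have [Cl dFt] := dFle t at_.
  rewrite /dD pmulr_rle0 ?expR_gt0// (le_trans (lerD dFt (lexx _)))//.
  rewrite -mulrDl mulr_le0_ge0//; last exact: ltW.
  by rewrite addrC subr_le0.
- by rewrite /D subrr mulr0 expR0 mul1r lerBlDr lerDl.
Qed.

Lemma relaxation_cvg F dF l a C : 0 < C ->
    (forall t, a <= t -> 0 <= F t) ->
    (forall t, a <= t -> is_derive t 1 F (dF t)) ->
    (forall e, 0 < e -> \forall t \near +oo,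
       C <= l t /\ dF t <= - l t * (F t - e)) ->
  F t @[t --> +oo] --> 0.
Proof.
move=> C0 F0 dvF dFle; apply/cvgr0Pnorm_le => e e0.
have e2 : 0 < e / 2 by rewrite divr_gt0.
have [m [_ mP]] := dFle _ e2.
pose b := Num.max a (m + 1).
have ab : a <= b by rewrite le_max lexx.
have mb : m < b by rewrite lt_max ltrDl ltr01 orbT.
have Fb0 := F0 b ab.
exists (b + F b / (C * (e / 2))); split; first exact: num_real.
move=> t tlt.
have bt : b <= t.
  by rewrite (le_trans _ (ltW tlt))// lerDl divr_ge0// mulr_ge0// ltW.
rewrite ger0_norm ?F0 ?(le_trans ab)//.
have Fle := @relaxation F dF l b C (e / 2) (ltW e2) Fb0
  (fun u bu => dvF u (le_trans ab bu))
  (fun u bu => mP u (lt_le_trans mb bu)) t bt.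
rewrite (le_trans Fle)// [leRHS]splitr lerD2l expRN ler_pdivrMr ?expR_gt0//.
(* As e^x >= x, this makes the exponential term at most e / 2. *)
have Ct : F b <= e / 2 * (C * (t - b)).
  move: tlt; rewrite -ltrBrDl ltr_pdivrMr ?mulr_gt0// => /ltW /le_trans; apply.
  by rewrite [leLHS](_ : _ = e / 2 * (C * (t - b)))//; ring.
rewrite (le_trans Ct)// ler_pM2l//.
have Ctb : 0 <= C * (t - b) by rewrite mulr_ge0 ?subr_ge0// ltW.
by apply: le_trans (expR_ge1Dxn 0 Ctb); rewrite expr1 divr1 lerDr.
Qed.

End Gronwall.

(** * Convergence of the chain *)

Section Convergence.
Set Implicit Arguments.
Unset Strict Implicit.
Context {R : realType} {X : finType}.
Implicit Types (U pi mu : X -> R) (Q : X -> X -> R) (T : R -> R)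
  (P : R -> R -> X -> X -> R) (s t : R) (x y : X).

Lemma is_derive_sum_fin (I : finType) (h : I -> R -> R) (dh : I -> R) (t : R) :
  (forall i, is_derive t 1 (h i) (dh i)) ->
  is_derive t 1 (fun u => \sum_i h i u) (\sum_i dh i).
Proof.
move=> dvh; have -> : (fun u => \sum_i h i u) = \sum_i h i.
  by apply/funext => u; rewrite fct_sumE.
elim/big_ind2 : _ => // [|f df g dg dvf dvg].
  exact: is_derive_cst.
exact: is_deriveD.
Qed.

Lemma cvg_sum_fin (I : finType) (h : I -> R -> R) (l : I -> R)
    (F : set_system R) :
  Filter F -> (forall i, h i u @[u --> F] --> l i) ->
  \sum_i h i u @[u --> F] --> \sum_i l i.
Proof. by move=> FF hl; apply: cvg_big => //; exact: add_continuous. Qed.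

Lemma inv_temp_pos T t : 0 < t -> inv_temp T t = (T t)^-1.
Proof. by move=> t0; rewrite /inv_temp gt_eqF. Qed.

Lemma is_derive_inv_temp T t : 0 < t -> 0 < T t -> derivable T t 1 ->
  is_derive t 1 (inv_temp T) (- (derive1 T t / T t ^+ 2)).
Proof.
move=> t0 Tt0 dvT.
have dT : is_derive t 1 T (derive1 T t) by rewrite derive1E; exact/derivableP.
apply: (@near_eq_is_derive _ _ _ (fun u => (T u)^-1)).
  near=> u; rewrite inv_temp_pos//; near: u; exact: lt_nbhsr.
apply: is_derive_eq (is_deriveV _ dT) _; first by rewrite gt_eqF.
by rewrite /GRing.scale/= mulNr mulrC.
Unshelve. all: by end_near. Qed.

Section ChiSquareDecay.
Variables (U : X -> R) (Q : X -> X -> R) (pi : X -> R) (x0 : X).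
Hypotheses (hQ : ergodic_generator Q) (hpi : stationary Q pi)
  (hrev : reversible Q pi) (U_ge0 : forall x, 0 <= U x) (Ux0 : U x0 = 0)
  (hc : c_M2 U Q <= 0).
Variables (T : R -> R) (P : R -> R -> X -> X -> R).
Hypotheses (hT : cooling_schedule T) (dvT : differentiable_schedule T)
  (hP : transition_semigroup (M2 U Q T) P)
  (condT : cooling_condition (c_M2 U Q) T).

Let c := c_M2 U Q.
Let pi_gt0 : forall x, 0 < pi x := stationary_gt0 hQ hpi hrev.
Let pi1 : \sum_x pi x = 1. Proof. by case: hpi => -[]. Qed.
Let b := inv_temp T.
Let db (t : R) := - (derive1 T t / T t ^+ 2).
Let M := \sum_x `|U x|.

Lemma schedule_gt0 t : 0 < t -> 0 < T t.
Proof. by case: hT => T0 _ _ t0; apply: T0; left. Qed.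

Lemma inv_temp_gt0 t : 0 < t -> 0 < b t.
Proof. by move=> t0; rewrite /b inv_temp_pos// invr_gt0 schedule_gt0. Qed.

Lemma sum_transition s t x : 0 <= s -> s <= t -> \sum_y P s t x y = 1.
Proof. by case: hP => distP _ _ _ _ s0 st; have [] := distP s t x s0 st. Qed.

(** The first summand of each term comes from the forward equation, the second
    from the motion of the Gibbs measure. *)
Definition dchi2 s x t : R :=
  \sum_y (2 * P s t x y * (\sum_z P s t x z * M2 U Q T t z y)
            * inv_gibbs U pi (b t) y
          + P s t x y ^+ 2 * \sum_z pi z / pi y *
              (expR (b t * (U y - U z)) * (db t * (U y - U z)))).

Lemma is_derive_chi2 s x t : 0 <= s -> s < t ->
  is_derive t 1 (fun u => chi2 U pi (b u) (P s u x)) (dchi2 s x t).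
Proof.
move=> s0 st; have t0 := le_lt_trans s0 st.
have dvb : is_derive t 1 b (db t).
  by apply: is_derive_inv_temp => //; [exact: schedule_gt0|exact: dvT].
rewrite /chi2 -[dchi2 s x t]subr0.
apply: is_deriveB; apply: is_derive_sum_fin => y.
have dvP : is_derive t 1 (fun u => P s u x y)
    (\sum_z P s t x z * M2 U Q T t z y).
  by case: hP => _ _ _ _; exact.
have dvg : is_derive t 1 (fun u => inv_gibbs U pi (b u) y)
    (\sum_z pi z / pi y * (expR (b t * (U y - U z)) * (db t * (U y - U z)))).
  apply: is_derive_sum_fin => z.
  have dvbU : is_derive t 1 (fun u => b u * (U y - U z)) (db t * (U y - U z)).
    apply: is_derive_eq; rewrite /GRing.scale/=; ring.
  have dvE := @is_derive1_comp R expR _ t _ _ (is_derive_expR _) dvbU.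
  apply: is_derive_eq; rewrite /GRing.scale/=; ring.
apply: is_derive_eq; rewrite /GRing.scale/=; ring.
Qed.

(** The forward equation gives the dissipation; in the other part, each
    exponential has derivative at most |b'| M times itself. *)
Lemma dchi2_le : exists2 C : R, 0 < C & forall (s : R) x t, 0 <= s -> s < t ->
  dchi2 s x t <= - 2 * (C * expR (- (b t * c))) * chi2 U pi (b t) (P s t x)
    + `|db t| * M * (chi2 U pi (b t) (P s t x) + 1).
Proof.
have [C C0 HC] := chi2_dissipation hQ hpi hrev Ux0.
exists C => // s x t s0 st; have t0 := le_lt_trans s0 st.
rewrite /dchi2 big_split/= lerD//.
  have := HC T t (P s t x) (ltW (inv_temp_gt0 t0))
    (sum_transition x s0 (ltW st)).
  rewrite -/b -/c => le.
  rewrite (_ : \sum_y _ = 2 * \sum_y P s t x y * inv_gibbs U pi (b t) y *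
      \sum_z P s t x z * M2 U Q T t z y); first by lra.
  by rewrite mulr_sumr; apply: eq_bigr => y _; ring.
rewrite {1}/chi2 subrK mulr_sumr ler_sum// => y _.
rewrite mulrCA ler_wpM2l ?sqr_ge0// /inv_gibbs mulr_sumr ler_sum// => z _.
rewrite [leRHS]mulrCA ler_wpM2l//; first by rewrite divr_ge0// ltW.
rewrite [leRHS]mulrC ler_wpM2l ?expR_ge0//.
rewrite (le_trans (ler_norm _))// normrM ler_wpM2l//.
have := ler_sum_norm U y; have := ler_sum_norm U z; rewrite -/M => UzM UyM.
have := U_ge0 y; have := U_ge0 z => Uz Uy.
by rewrite ler_norml; apply/andP; split; lra.
Qed.

(** The cooling condition makes |b'| M at most min(e, 1) times the gap
    l = C e^(- b c).  Then |b'| M F is absorbed by half of the dissipation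
    2 l F, and |b'| M contributes at most e l. *)
Lemma chi2_cvg0 s x : 0 <= s -> chi2 U pi (b t) (P s t x) @[t --> +oo] --> 0.
Proof.
move=> s0; have [C C0 HC] := dchi2_le.
have M0 : 0 <= M by exact: sumr_ge0.
have lt_s t : s + 1 <= t -> s < t by apply: lt_le_trans; rewrite ltrDl.
apply: (@relaxation_cvg _ _ (dchi2 s x)
  (fun t => C * expR (- (b t * c))) (s + 1) C) => //.
- by move=> t /lt_s st; apply: chi2_ge0 => //; exact: sum_transition (ltW st).
- by move=> t /lt_s st; exact: is_derive_chi2.
move=> e e0.
pose e' := Num.min e 1.
have e'0 : 0 < e' by rewrite lt_min e0 ltr01.
pose d := e' * C / (M + 1).
have M1 : 0 < M + 1 by rewrite ltr_wpDl.
have d0 : 0 < d by rewrite divr_gt0// mulr_gt0.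
have near_d : \forall t \near +oo,
    `|derive1 T t * (expR (c / T t) / T t ^+ 2)| <= d.
  by move/cvgr0_norm_le: condT; apply.
near=> t.
have st : s < t by apply: lt_s; near: t; apply: nbhs_pinfty_ge; exact: num_real.
have t0 := le_lt_trans s0 st.
have bt0 := inv_temp_gt0 t0.
have bc : b t * c <= 0 by rewrite mulr_ge0_le0// ltW.
split.
  by apply: ler_peMr; [exact: ltW|rewrite -[leLHS]expR0 ler_expR oppr_ge0].
have F0 : 0 <= chi2 U pi (b t) (P s t x).
  by apply: chi2_ge0 => //; exact: sum_transition (ltW st).
have dbM : `|db t| * M <= e' * (C * expR (- (b t * c))).
  have : `|db t| * expR (b t * c) <= d.
    have -> : `|db t| * expR (b t * c) =
        `|derive1 T t * (expR (c / T t) / T t ^+ 2)|.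
      rewrite /b inv_temp_pos// (mulrC _ c).
      rewrite -[X in _ * X = _]gtr0_norm ?expR_gt0//.
      by rewrite -normrM /db mulNr normrN; congr `|_|; ring.
    by near: t.
  rewrite -ler_pdivlMr ?expR_gt0// -expRN => /(ler_wpM2r M0)/le_trans; apply.
  rewrite mulrAC [leRHS]mulrA; apply: ler_wpM2r; first exact: expR_ge0.
  rewrite /d mulrAC ler_pdivrMr//; apply: ler_wpM2l; last by rewrite lerDl.
  by rewrite mulr_ge0// ltW.
have e'1 : e' <= 1 by rewrite ge_min lexx orbT.
have e'e : e' <= e by rewrite ge_min lexx.
move: (HC s x t s0 st) F0 dbM; set F := chi2 _ _ _ _; set l := C * _.
set B := _ * M => dF F0 BM.
have l0 : 0 <= l by rewrite mulr_ge0 ?expR_ge0 ?ltW.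
apply: (le_trans dF).
have := ler_wpM2r (_ : 0 <= F + 1) BM; rewrite addr_ge0// => /(_ isT).
have : e' * l <= l by rewrite ler_piMl.
have : e' * l <= e * l by rewrite ler_wpM2r.
have := ler_wpM2r F0 (_ : e' * l <= l); rewrite ler_piMl// => /(_ isT).
nra.
Unshelve. all: by end_near. Qed.

Lemma inv_temp_cvg : b t @[t --> +oo] --> +oo.
Proof.
have Tinv : (T t)^-1 @[t --> +oo] --> +oo.
  apply/cvgrVy; last by case: hT.
  near=> t; apply: schedule_gt0; near: t.
  by apply: nbhs_pinfty_gt; exact: num_real.
apply: cvg_trans Tinv; apply: near_eq_cvg; near=> t.
rewrite /b inv_temp_pos//; near: t; apply: nbhs_pinfty_gt; exact: num_real.
Unshelve. all: by end_near. Qed.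

Lemma in_UminE x : in_Umin U x = (U x == 0).
Proof.
apply/forallP/eqP => [Ule|-> //]; apply/eqP; rewrite eq_le U_ge0 andbT.
by rewrite -Ux0 Ule.
Qed.

Lemma weight_cvg x :
  weight U pi (b t) x @[t --> +oo] --> (if in_Umin U x then pi x else 0).
Proof.
rewrite in_UminE /weight; have [->|Ux] := eqVneq (U x) 0.
  under eq_fun do rewrite mulr0 oppr0 expR0 mulr1; exact: cvg_cst.
rewrite -[X in _ --> X](mulr0 (pi x)); apply: cvgM; first exact: cvg_cst.
have Ux_gt0 : 0 < U x by rewrite lt_neqAle eq_sym Ux U_ge0.
exact: (cvg_comp _ _ (gt0_cvgMly Ux_gt0 inv_temp_cvg) (@cvgr_expR R)).
Qed.

Lemma pi_Umin_gt0 : 0 < \sum_(y | in_Umin U y) pi y.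
Proof.
rewrite (bigD1 x0) /= ?in_UminE ?Ux0// ltr_pwDl// sumr_ge0// => y _.
exact: ltW.
Qed.

Lemma gibbs_cvg x : gibbs U pi (b t) x @[t --> +oo] --> pi_min U pi x.
Proof.
have -> : pi_min U pi x =
    (if in_Umin U x then pi x else 0) * (\sum_(y | in_Umin U y) pi y)^-1.
  by rewrite /pi_min; case: ifP => // _; rewrite mul0r.
apply: cvgM; first exact: weight_cvg.
apply: cvgV; first by rewrite gt_eqF// pi_Umin_gt0.
rewrite [X in _ --> X]big_mkcond/=; apply: cvg_sum_fin => y; exact: weight_cvg.
Qed.

Lemma is_distribution_pi_min : is_distribution (pi_min U pi).
Proof.
split=> [x|].
  by rewrite /pi_min; case: ifP => // _; rewrite divr_ge0 ?ltW// pi_Umin_gt0.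
rewrite /pi_min -big_mkcond/= -mulr_suml divff// gt_eqF//; exact: pi_Umin_gt0.
Qed.

Lemma transition_sub_gibbs_cvg s x y : 0 <= s ->
  P s t x y - gibbs U pi (b t) y @[t --> +oo] --> 0.
Proof.
move=> s0; apply/cvgr0Pnorm_le => e e0.
have e2 : 0 < e ^+ 2 by rewrite exprn_gt0.
have near_e : \forall t \near +oo, `|chi2 U pi (b t) (P s t x)| <= e ^+ 2.
  by move/cvgr0_norm_le: (chi2_cvg0 x s0); apply.
near=> t.
have st : s <= t by near: t; apply: nbhs_pinfty_ge; exact: num_real.
have : `|chi2 U pi (b t) (P s t x)| <= e ^+ 2 by near: t.
move=> /(le_trans (ler_norm _)).
have mu1 := sum_transition x s0 st.
move=> /(le_trans (sqr_sub_gibbs_le_chi2 U pi_gt0 pi1 (b t) y mu1)).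
by move=> /ler_wsqrtr; rewrite !sqrtr_sqr (ger0_norm (ltW e0)).
Unshelve. all: by end_near. Qed.

Lemma transition_cvg s x y : 0 <= s ->
  P s t x y @[t --> +oo] --> pi_min U pi y.
Proof.
move=> s0; rewrite -[X in _ --> X]add0r.
under eq_fun => t do rewrite -[P s t x y](subrK (gibbs U pi (b t) y)).
apply: cvgD; [exact: transition_sub_gibbs_cvg|exact: gibbs_cvg].
Qed.

Lemma converges_tv_pi_min : converges_tv P (pi_min U pi).
Proof.
move=> s s0; pose tv t x := tv_dist (P s t x) (pi_min U pi).
have tv0 t x : 0 <= tv t x by rewrite mulr_ge0// sumr_ge0.
have sum0 : \sum_(x : X) (0 : R) = 0 by rewrite big1.
have tv_cvg x : tv t x @[t --> +oo] --> 0.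
  rewrite -[X in _ --> X](mulr0 2^-1); apply: cvgM; first exact: cvg_cst.
  rewrite -[X in _ --> X]sum0.
  apply: cvg_sum_fin => y; rewrite -[X in _ --> X](normr0 R).
  apply: cvg_norm; rewrite -[X in _ --> X](subrr (pi_min U pi y)).
  by apply: cvgB; [exact: transition_cvg|exact: cvg_cst].
apply: (@squeeze_cvgr _ _ _ _ (cst 0) (fun t => \sum_x tv t x)).
- near=> t; apply/andP; split.
    apply: le_trans (tv0 t x0) _; apply: ub_le_sup; last by exists x0.
    exact: has_ubound_image.
  apply: ge_sup; first by exists (tv t x0), x0.
  by move=> _ [x _ <-]; rewrite (bigD1 x)//= lerDl sumr_ge0.
- exact: cvg_cst.
- rewrite -[X in _ --> X]sum0.
  exact: cvg_sum_fin.
Unshelve. all: by end_near. Qed.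

End ChiSquareDecay.
End Convergence.

(** * Cooling schedules *)

Section Schedules.
Set Implicit Arguments.
Unset Strict Implicit.
Context {R : realType}.
Implicit Types (g dg T : R -> R) (a c k p t : R).

Section FilterLimits.
Context {F : set_system R} {FF : Filter F}.
Implicit Types f : R -> R.

Lemma cvgy_expR f : f x @[x --> F] --> +oo -> expR (f x) @[x --> F] --> +oo.
Proof.
apply: ger_cvgy; apply: nearW => x.
by rewrite (le_trans _ (expR_ge1Dx _))// lerDr.
Qed.

Lemma cvgy_ln f : f x @[x --> F] --> +oo -> ln (f x) @[x --> F] --> +oo.
Proof.
move=> /cvgryPge fy; apply/cvgryPge => A; near=> x.
have fx : expR A <= f x by near: x; exact: fy.
by rewrite -(expRK A) ler_ln// posrE ?(lt_le_trans _ fx) ?expR_gt0.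
Unshelve. all: by end_near. Qed.

Lemma cvgy_powR a f : 0 < a -> f x @[x --> F] --> +oo ->
  f x `^ a @[x --> F] --> +oo.
Proof.
move=> a0 fy; have := cvgy_expR (@gt0_cvgMry _ _ FF _ _ a0 (cvgy_ln fy)).
move=> lim; apply: cvg_trans lim; apply: near_eq_cvg; near=> x.
by rewrite /powR gt_eqF//; near: x; exact: cvgry_gt.
Unshelve. all: by end_near. Qed.

Lemma cvg0_powRN a f : 0 < a -> f x @[x --> F] --> +oo ->
  f x `^ (- a) @[x --> F] --> 0.
Proof.
move=> a0 fy; under eq_fun do rewrite powRN.
apply/gtr0_cvgV0; last exact: cvgy_powR.
by near=> x; rewrite powR_gt0//; near: x; exact: cvgry_gt.
Unshelve. all: by end_near. Qed.

(** Writing ln y = (2/a) ln (y^(a/2)) <= (2/a) y^(a/2) leaves a factor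
    y^(-a/2). *)
Lemma cvg0_ln_powRN a f : 0 < a -> f x @[x --> F] --> +oo ->
  ln (f x) * f x `^ (- a) @[x --> F] --> 0.
Proof.
move=> a0 fy; have a2 : 0 < a / 2 by rewrite divr_gt0.
apply: (@squeeze_cvgr _ _ _ _ (cst 0)
  (fun x => (a / 2)^-1 * f x `^ (- (a / 2)))).
- near=> x.
  have fx1 : 1 <= f x by near: x; exact: cvgry_ge.
  have fx0 : 0 < f x by rewrite (lt_le_trans _ fx1).
  rewrite mulr_ge0 ?powR_ge0 ?ln_ge0//=.
  have -> : - a = - (a / 2) + - (a / 2) by rewrite -opprD -splitr.
  rewrite powRD ?(gt_eqF fx0) ?implybT// mulrA ler_wpM2r ?powR_ge0//.
  rewrite powRN ler_pdivrMr ?powR_gt0// ler_pdivlMl// -ln_powR.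
  by rewrite ltW// ln_sublinear// powR_gt0.
- exact: cvg_cst.
- rewrite -[X in _ --> X](mulr0 (a / 2)^-1); apply: cvgM; first exact: cvg_cst.
  exact: cvg0_powRN.
Unshelve. all: by end_near. Qed.

(** Eventually p ln y <= y / 2, so the product is at most e^(- y / 2). *)
Lemma cvg0_powR_expRN p f : f x @[x --> F] --> +oo ->
  f x `^ p * expR (- f x) @[x --> F] --> 0.
Proof.
move=> fy.
have half : f x / 2 @[x --> F] --> +oo by apply: gt0_cvgMly.
apply: (@squeeze_cvgr _ _ _ _ (cst 0) (fun x => expR (- (f x / 2)))).
- have lnf : p * (ln (f x) * f x `^ (- 1)) @[x --> F] --> 0.
    rewrite -[X in _ --> X](mulr0 p); apply: cvgM; first exact: cvg_cst.
    exact: cvg0_ln_powRN.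
  near=> x.
  have fx0 : 0 < f x by near: x; exact: cvgry_gt.
  rewrite mulr_ge0 ?powR_ge0 ?expR_ge0//=.
  rewrite /powR gt_eqF// -expRD ler_expR.
  have : p * (ln (f x) * f x `^ (- 1)) <= 2^-1.
    by near: x; apply: (cvgr_le 0) => //; rewrite invr_gt0.
  rewrite powR_inv1 ?(ltW fx0)// mulrA ler_pdivrMr//; lra.
- exact: cvg_cst.
- exact: (cvg_comp _ _ half (@cvgr_expR R)).
Unshelve. all: by end_near. Qed.

Lemma cvg0_mul_expR c f : c < 0 -> f x @[x --> F] --> +oo ->
  f x * expR (c * f x) @[x --> F] --> 0.
Proof.
move=> c0 fy; have cf : - c * f x @[x --> F] --> +oo.
  by apply: gt0_cvgMry => //; rewrite oppr_gt0.
have := cvg0_powR_expRN 1 cf.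
move=> /(cvgM (cvg_cst (- c)^-1)) /=; rewrite mulr0.
move=> lim; apply: cvg_trans lim; apply: near_eq_cvg; near=> x.
rewrite /= powRr1; last by near: x; exact: cvgry_ge.
by rewrite mulrA mulKf ?oppr_eq0 ?lt_eqF// mulNr opprK.
Unshelve. all: by end_near. Qed.

End FilterLimits.

Lemma cvgy_shift1 : t + 1 @[t --> +oo] --> (+oo : set_system R).
Proof.
apply: (@ger_cvgy _ _ _ _ id); last exact: cvg_id.
by apply: nearW => t; rewrite lerDl.
Qed.

Lemma cvgy_ln_shift1 : ln (t + 1) @[t --> +oo] --> (+oo : set_system R).
Proof. by apply: cvgy_ln; exact: cvgy_shift1. Qed.

Lemma cvg0_mul_expR_le1 c g dg : c <= 0 -> g t @[t --> +oo] --> +oo ->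
  dg t @[t --> +oo] --> 0 -> dg t * expR (c * g t) @[t --> +oo] --> 0.
Proof.
move=> c0 gy dg0; apply/cvgr0Pnorm_le => e e0; near=> t.
have gt0 : 0 <= g t by near: t; exact: cvgry_ge.
have dgt : `|dg t| <= e by near: t; move/cvgr0_norm_le: dg0; apply.
rewrite normrM (ger0_norm (expR_ge0 _)) (le_trans _ dgt)// ler_piMr//.
by rewrite -[leRHS]expR0 ler_expR mulr_le0_ge0.
Unshelve. all: by end_near. Qed.

(** For T = 1/g, T' / T^2 = - g', so the cooling condition reads
    g' e^(c g) -> 0.  The last hypothesis covers the two ways in which time 0
    is treated in [schedule_domain]. *)
Lemma admissible_inv c T g dg : (forall t, T t = (g t)^-1) ->
    (forall t, 0 < t -> 0 < g t) ->
    (forall t, 0 < t -> is_derive t 1 g (dg t)) ->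
    (forall s t, 0 < s -> s <= t -> g s <= g t) ->
    g t @[t --> +oo] --> +oo -> dg t * expR (c * g t) @[t --> +oo] --> 0 ->
    blows_up_at0 T \/ (0 < g 0 /\ forall t, 0 < t -> g 0 <= g t) ->
  admissible_schedule c T.
Proof.
move=> TE g0 dvg gle gy cond zero.
have dvT t : 0 < t -> is_derive t 1 T (- (dg t / g t ^+ 2)).
  move=> t0; have -> : T = (fun t => (g t)^-1) by apply/funext.
  apply: is_derive_eq (is_deriveV _ (dvg t t0)) _; first by rewrite gt_eqF ?g0.
  by rewrite /GRing.scale/= mulNr mulrC.
split; first split.
- move=> t [t0|[-> nb]]; first by rewrite TE invr_gt0 g0.
  by case: zero => // -[g00 _]; rewrite TE invr_gt0.
- move=> s t [s0|[-> nb]] [t0|[-> _]] st //; rewrite !TE.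
  + by rewrite lef_pV2 ?posrE ?g0// gle.
  + by move: st; rewrite leNgt s0.
  + case: zero => // -[g00 gle0].
    by rewrite lef_pV2 ?posrE ?g00 ?gle0 ?g0.
- under eq_fun do rewrite TE; apply/gtr0_cvgV0; last exact: gy.
  by near=> t; near: t; exact: cvgry_gt.
- by move=> t t0; have := dvT t t0 => ?; exact: ex_derive.
- rewrite /cooling_condition; move/cvgN : cond; rewrite oppr0.
  move=> lim; apply: cvg_trans lim; apply: near_eq_cvg; near=> t.
  have t0 : 0 < t by near: t; apply: nbhs_pinfty_gt; exact: num_real.
  have g0t : g t != 0 by rewrite gt_eqF ?g0.
  rewrite derive1E (@derive_val _ _ _ _ _ _ _ (dvT t t0)) TE invrK opprfctE.
  by field.
Unshelve. all: by end_near. Qed.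

Lemma blows_up_at0_ge T k : 0 < k ->
  (forall t, 0 < t < 1 -> k * t^-1 <= T t) -> blows_up_at0 T.
Proof.
move=> k0 Tge; apply: (@ger_cvgy _ _ _ _ (fun t => k * t^-1)).
  by near=> t; apply: Tge; apply/andP; split.
apply: gt0_cvgMry => //; apply/cvgrVy; last first.
  by apply: cvg_at_right_filter; exact: cvg_id.
by near=> t.
Unshelve. all: by end_near. Qed.

Lemma is_derive_shift1 t : is_derive t 1 (fun u : R => u + 1) 1.
Proof. by apply: is_derive_eq; rewrite addr0. Qed.

Lemma is_derive_powR_shift1 a t : 0 < t ->
  is_derive t 1 (fun u => (u + 1) `^ a) (a * (t + 1) `^ (a - 1)).
Proof.
move=> t0; have t1 : 0 < t + 1 by rewrite addr_gt0.
have := @is_derive1_comp R (fun x => x `^ a) _ t _ _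
  (is_derive1_powR a t1) (is_derive_shift1 t).
by rewrite mulr1.
Qed.

Lemma is_derive_ln_shift1 t : 0 < t ->
  is_derive t 1 (fun u => ln (u + 1)) (t + 1)^-1.
Proof.
move=> t0; have t1 : 0 < t + 1 by rewrite addr_gt0.
have := @is_derive1_comp R (@ln R) _ t _ _
  (is_derive1_ln t1) (is_derive_shift1 t).
by rewrite mulr1.
Qed.

Lemma powR_shift1_gt0 a t : 0 <= t -> 0 < (t + 1) `^ a.
Proof. by move=> t0; rewrite powR_gt0// ltr_wpDl. Qed.

Lemma ln_shift1_gt0 t : 0 < t -> 0 < ln (t + 1).
Proof. by move=> t0; rewrite ln_gt0// ltrDr. Qed.

Lemma ler_powR_shift1 a s t : 0 < a -> 0 <= s -> s <= t ->
  (s + 1) `^ a <= (t + 1) `^ a.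
Proof.
move=> a0 s0 st; have t0 := le_trans s0 st.
by apply: ge0_ler_powR; rewrite ?nnegrE ?addr_ge0 ?lerD2r// ltW.
Qed.

Lemma ler_ln_shift1 s t : 0 < s -> s <= t -> ln (s + 1) <= ln (t + 1).
Proof.
move=> s0 st; have t0 := lt_le_trans s0 st.
by rewrite ler_ln ?posrE ?addr_gt0// lerD2r.
Qed.

Lemma ln_shift1_le t : 0 <= t -> ln (t + 1) <= t.
Proof. by move=> t0; rewrite addrC le_ln1Dx// (lt_le_trans _ t0)// ltrN10. Qed.

Lemma sched_pow_admissible a c : 0 < a ->
  a * (t + 1) `^ (a - 1) * expR (c * (t + 1) `^ a) @[t --> +oo] --> 0 ->
  admissible_schedule c (sched_pow a).
Proof.
move=> a0 cond; apply: (admissible_inv (g := fun t => (t + 1) `^ a)) cond _.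
- by move=> t; rewrite /sched_pow powRN.
- by move=> t t0; rewrite powR_shift1_gt0// ltW.
- by move=> t; exact: is_derive_powR_shift1.
- by move=> s t /ltW s0 st; rewrite ler_powR_shift1.
- by apply: cvgy_powR => //; exact: cvgy_shift1.
- right; split=> [|t t0]; first exact: powR_shift1_gt0.
  by rewrite ler_powR_shift1// ltW.
Qed.

Lemma sched_pow_lt1 a c : c <= 0 -> 0 < a < 1 ->
  admissible_schedule c (sched_pow a).
Proof.
move=> c0 /andP[a0 a1]; apply: sched_pow_admissible => //.
apply: cvg0_mul_expR_le1 => //.
  by apply: cvgy_powR => //; exact: cvgy_shift1.
rewrite -[X in _ --> X](mulr0 a); apply: cvgM; first exact: cvg_cst.
rewrite -opprB; apply: cvg0_powRN; last exact: cvgy_shift1.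
by rewrite subr_gt0.
Qed.

(** As t + 1 >= 1, the derivative of g = (t + 1)^a is at most a g. *)
Lemma sched_pow_neg a c : c < 0 -> 0 < a -> admissible_schedule c (sched_pow a).
Proof.
move=> c0 a0; apply: sched_pow_admissible => //.
have gy : (t + 1) `^ a @[t --> +oo] --> (+oo : set_system R).
  by apply: cvgy_powR => //; exact: cvgy_shift1.
apply: (@squeeze_cvgr _ _ _ _ (cst 0)
  (fun t => a * ((t + 1) `^ a * expR (c * (t + 1) `^ a)))).
- near=> t; have t0 : 0 <= t by near: t; apply: nbhs_pinfty_ge; exact: num_real.
  rewrite !mulr_ge0 ?powR_ge0 ?expR_ge0 ?(ltW a0)//=.
  rewrite -mulrA; apply: ler_wpM2l; first exact: ltW.
  apply: ler_wpM2r; first exact: expR_ge0.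
  by apply: ler_powR; rewrite ?lerDr// gerBl.
- exact: cvg_cst.
- rewrite -[X in _ --> X](mulr0 a); apply: cvgM; first exact: cvg_cst.
  exact: cvg0_mul_expR.
Unshelve. all: by end_near. Qed.

(** With z = ln (t + 1), the derivative of g = z^k is k z^(k-1) e^(-z). *)
Lemma sched_log_gt1 k c : c <= 0 -> 1 < k ->
  admissible_schedule c (sched_log k).
Proof.
move=> c0 k1; have k0 : 0 < k by rewrite (lt_trans _ k1).
have gy : ln (t + 1) `^ k @[t --> +oo] --> (+oo : set_system R).
  by apply: cvgy_powR => //; exact: cvgy_ln_shift1.
apply: (admissible_inv (g := fun t => ln (t + 1) `^ k)
    (dg := fun t => k * ln (t + 1) `^ (k - 1) * (t + 1)^-1)) => //.
- by move=> t; rewrite /sched_log powRN.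
- by move=> t t0; rewrite powR_gt0 ?ln_shift1_gt0.
- move=> t t0; apply: (@is_derive1_comp R (fun x => x `^ k)).
    exact/is_derive1_powR/ln_shift1_gt0.
  exact: is_derive_ln_shift1.
- move=> s t s0 st; have t0 := lt_le_trans s0 st.
  by apply: ge0_ler_powR; rewrite ?nnegrE ?ler_ln_shift1// ltW ?ln_shift1_gt0.
- apply: cvg0_mul_expR_le1 => //.
  have : k * (ln (t + 1) `^ (k - 1) * expR (- ln (t + 1))) @[t --> +oo] --> 0.
    rewrite -[X in _ --> X](mulr0 k); apply: cvgM; first exact: cvg_cst.
    by apply: cvg0_powR_expRN; exact: cvgy_ln_shift1.
  move=> lim; apply: cvg_trans lim; apply: near_eq_cvg; near=> t.
  have t0 : 0 < t by near: t; apply: nbhs_pinfty_gt; exact: num_real.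
  by rewrite /= expRN lnK ?posrE ?addr_gt0// mulrA.
- left; apply: (@blows_up_at0_ge _ 1) => // t /andP[t0 t1].
  have l0 := ln_shift1_gt0 t0; have lt := ln_shift1_le (ltW t0).
  rewrite mul1r /sched_log (@le_trans _ _ (ln (t + 1) `^ (- 1)))//.
    by rewrite powR_inv1 ?(ltW l0)// lef_pV2 ?posrE.
  apply: ger_powR; last by rewrite lerN2 ltW.
  by rewrite l0/= (le_trans lt)// ltW.
Unshelve. all: by end_near. Qed.

Lemma sched_powlog_lt1 a c : c <= 0 -> 0 < a < 1 ->
  admissible_schedule c (sched_powlog a).
Proof.
move=> c0 /andP[a0 a1]; have a1' : 0 < 1 - a by rewrite subr_gt0.
have py : (t + 1) `^ a @[t --> +oo] --> (+oo : set_system R).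
  by apply: cvgy_powR => //; exact: cvgy_shift1.
have gy : (t + 1) `^ a * ln (t + 1) @[t --> +oo] --> (+oo : set_system R).
  apply: (ger_cvgy _ py); near=> t; rewrite ler_peMr ?powR_ge0//.
  by near: t; apply: (cvgry_ge cvgy_ln_shift1).
apply: (admissible_inv (g := fun t => (t + 1) `^ a * ln (t + 1))
    (dg := fun t => (t + 1) `^ a * (t + 1)^-1
                    + ln (t + 1) * (a * (t + 1) `^ (a - 1)))) => //.
- by move=> t; rewrite /sched_powlog powRN invfM.
- by move=> t t0; rewrite mulr_gt0 ?ln_shift1_gt0// powR_shift1_gt0// ltW.
- move=> t t0; apply: is_deriveM; first exact: is_derive_powR_shift1.
  exact: is_derive_ln_shift1.
- move=> s t s0 st; have t0 := lt_le_trans s0 st.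
  apply: ler_pM; rewrite ?powR_ge0// ?ler_ln_shift1//.
    by rewrite ltW// ln_shift1_gt0.
  by rewrite ler_powR_shift1// ltW.
- apply: cvg0_mul_expR_le1 => //; rewrite -[X in _ --> X]addr0; apply: cvgD.
    have : (t + 1) `^ (- (1 - a)) @[t --> +oo] --> 0.
      by apply: cvg0_powRN => //; exact: cvgy_shift1.
    move=> lim; apply: cvg_trans lim; apply: near_eq_cvg; near=> t.
    have t0 : 0 < t + 1.
      by rewrite addr_gt0//; near: t; apply: nbhs_pinfty_gt; exact: num_real.
    by rewrite opprB powRB ?powRr1 ?(ltW t0)// (gt_eqF t0) implybT.
  rewrite -[X in _ --> X](mulr0 a).
  under eq_fun do rewrite mulrCA -opprB; apply: cvgM; first exact: cvg_cst.
  by apply: cvg0_ln_powRN => //; exact: cvgy_shift1.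
- left; apply: (@blows_up_at0_ge _ (2 `^ (- a))); first by rewrite powR_gt0.
  move=> t /andP[t0 t1]; have l0 := ln_shift1_gt0 t0.
  apply: ler_pM; rewrite ?powR_ge0 ?invr_ge0 ?(ltW t0)//.
    rewrite !powRN lef_pV2 ?posrE ?powR_gt0// ?addr_gt0//.
    apply: ge0_ler_powR; rewrite ?nnegrE ?addr_ge0 ?(ltW a0) ?(ltW t0)//.
    lra.
  by rewrite lef_pV2 ?posrE// ln_shift1_le// ltW.
Unshelve. all: by end_near. Qed.

Lemma sched_exp_neg c : c < 0 -> admissible_schedule c (@sched_exp R).
Proof.
move=> c0; have gy : expR t @[t --> +oo] --> (+oo : set_system R).
  exact: cvgy_expR cvg_id.
apply: (admissible_inv (g := expR) (dg := expR)) => //.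
- by move=> t; rewrite /sched_exp expRN.
- by move=> t _; exact: expR_gt0.
- by move=> s t _ st; rewrite ler_expR.
- exact: cvg0_mul_expR.
- by right; split=> [|t t0]; rewrite ?expR_gt0// ler_expR ltW.
Qed.

Lemma sched_pow_below_log a : 0 < a -> below_log (sched_pow a).
Proof.
move=> a0; rewrite /below_log; under eq_fun do rewrite mulrC.
by apply: cvg0_ln_powRN => //; exact: cvgy_shift1.
Qed.

Lemma sched_log_below_log k : 1 < k -> below_log (sched_log k).
Proof.
move=> k1; have : ln (t + 1) `^ (- (k - 1)) @[t --> +oo] --> 0.
  by apply: cvg0_powRN; [rewrite subr_gt0|exact: cvgy_ln_shift1].
move=> lim; apply: cvg_trans lim; apply: near_eq_cvg; near=> t.
have t0 : 0 < t by near: t; apply: nbhs_pinfty_gt; exact: num_real.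
have l0 := ln_shift1_gt0 t0.
rewrite /sched_log opprB powRB ?(gt_eqF l0) ?implybT//.
by rewrite powRr1 ?(ltW l0)// powRN mulrC.
Unshelve. all: by end_near. Qed.

Lemma sched_powlog_below_log a : 0 < a -> below_log (sched_powlog a).
Proof.
move=> a0; have : (t + 1) `^ (- a) @[t --> +oo] --> 0.
  by apply: cvg0_powRN => //; exact: cvgy_shift1.
move=> lim; apply: cvg_trans lim; apply: near_eq_cvg; near=> t.
have t0 : 0 < t by near: t; apply: nbhs_pinfty_gt; exact: num_real.
by rewrite /sched_powlog mulfVK// gt_eqF// ln_shift1_gt0.
Unshelve. all: by end_near. Qed.

Lemma sched_exp_below_log : below_log (@sched_exp R).
Proof.
apply: (@squeeze_cvgr _ _ _ _ (cst 0) (fun t => t `^ 1 * expR (- t))).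
- near=> t; have t0 : 0 < t by near: t; apply: nbhs_pinfty_gt; exact: num_real.
  have l0 := ltW (ln_shift1_gt0 t0).
  rewrite /sched_exp powRr1 ?(ltW t0)// mulr_ge0 ?expR_ge0//=.
  by rewrite mulrC ler_wpM2r ?expR_ge0// ln_shift1_le// ltW.
- exact: cvg_cst.
- exact: cvg0_powR_expRN cvg_id.
Unshelve. all: by end_near. Qed.

End Schedules.

Theorem theorem3p2 (R : realType) (X : finType) (U : X -> R)
    (Q : X -> X -> R) (pi : X -> R)
    (hX : (2 <= #|X|)%N)
    (hU : (forall x, 0 <= U x) /\ (exists x, U x = 0))
    (hQ : ergodic_generator Q)
    (hpi : stationary Q pi)
    (hrev : reversible Q pi)
    (hc : c_M2 U Q <= 0) :
  [/\ forall (T : R -> R) (P : R -> R -> X -> X -> R),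
        cooling_schedule T -> differentiable_schedule T ->
        transition_semigroup (M2 U Q T) P ->
        cooling_condition (c_M2 U Q) T ->
        strongly_ergodic P /\ converges_tv P (pi_min U pi),
      c_M2 U Q = 0 ->
        [/\ forall a : R, 0 < a < 1 ->
              admissible_schedule (c_M2 U Q) (sched_pow a),
            forall k : R, 1 < k ->
              admissible_schedule (c_M2 U Q) (sched_log k)
          & forall a : R, 0 < a < 1 ->
              admissible_schedule (c_M2 U Q) (sched_powlog a)],
      c_M2 U Q < 0 ->
        [/\ forall a : R, 0 < a < 1 ->
              admissible_schedule (c_M2 U Q) (sched_pow a),
            forall k : R, 1 < k ->
              admissible_schedule (c_M2 U Q) (sched_log k),
            forall a : R, 0 < a < 1 ->
              admissible_schedule (c_M2 U Q) (sched_powlog a),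
            admissible_schedule (c_M2 U Q) (@sched_exp R)
          & forall a : R, 0 < a ->
              admissible_schedule (c_M2 U Q) (sched_pow a)]
    & [/\ forall a : R, 0 < a < 1 -> below_log (sched_pow a),
          forall k : R, 1 < k -> below_log (sched_log k),
          forall a : R, 0 < a < 1 -> below_log (sched_powlog a),
          below_log (@sched_exp R)
        & forall a : R, 0 < a -> below_log (sched_pow a)]].
Proof.
have [U0 [x0 Ux0]] := hU.
split.
- move=> T P hT dvT hP condT.
  have cvgP :=
    converges_tv_pi_min hQ hpi hrev U0 Ux0 hc hT dvT hP condT.
  split=> //; exists (pi_min U pi) => //.
  exact: (is_distribution_pi_min hQ hpi hrev U0 Ux0).
- by split=> *; [exact: sched_pow_lt1|exact: sched_log_gt1|
    exact: sched_powlog_lt1].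
- move=> c0; split=> *.
  + exact: sched_pow_lt1.
  + exact: sched_log_gt1.
  + exact: sched_powlog_lt1.
  + exact: sched_exp_neg.
  + exact: sched_pow_neg.
- split.
  + by move=> a /andP[a0 _]; exact: sched_pow_below_log.
  + exact: sched_log_below_log.
  + by move=> a /andP[a0 _]; exact: sched_powlog_below_log.
  + exact: sched_exp_below_log.
  + exact: sched_pow_below_log.
Qed.
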